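(* Let $p$ be a prime, $G$ a finite group and $P$ a normal $p$-subgroup of $G$. If every maximal subgroup of $P$ satisfies partial $\Pi$-property in $G$, then $P\leq Z_{\mathfrak{U}}(G)$.
   Context: All groups are finite. For a positive integer $n$ and a set of primes $\pi$, $n$ is a $\pi$-number if all its prime divisors lie in $\pi$ (so $1$ is a $\pi$-number for every $\pi$, including $\pi=\emptyset$); $\pi(H)$ is the set of prime divisors of $|H|$. Partial $\Pi$-property: a subgroup $H$ of $G$ satisfies partial $\Pi$-property in $G$ if there exists a chief series $1=G_0<G_1<\cdots<G_n=G$ of $G$ such that for every $1\leq i\leq n$, the index $|G/G_{i-1}:N_{G/G_{i-1}}(HG_{i-1}/G_{i-1}\cap G_i/G_{i-1})|$ is a $\pi(HG_{i-1}/G_{i-1}\cap G_i/G_{i-1})$-number. $\mathfrak{U}$ is the class of finite supersolvable groups. A chief factor $L/K$ of $G$ is $\mathfrak{U}$-central in $G$ if $(L/K)\rtimes(G/C_G(L/K))\in\mathfrak{U}$. $Z_{\mathfrak{U}}(G)$, the $\mathfrak{U}$-hypercentre of $G$, is the product of all normal subgroups $N$ of $G$ such that every $G$-chief factor below $N$ is $\mathfrak{U}$-central in $G$. *)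

(* Defs.v *)
From mathcomp Require Import all_boot all_fingroup all_solvable.

Set Implicit Arguments.
Unset Strict Implicit.
Unset Printing Implicit Defensive.

Import GroupScope.

(* By connectP, there is a chain 1 = A_0 <= ... <= A_n = A of normal subgroups
   of A with all the factors A_i / A_(i-1) cyclic. *)
Definition supersolvable (gT : finGroupType) (A : {group gT}) : bool :=
  connect [rel K L : {group gT} |
            [&& K <| A, L <| A, K \subset L & cyclic (L / K)]] 1%G A.

(* The semidirect product (L / K) ><| (G / C_G(L / K)) for the conjugation
   action, where K and L are normal in G and K is contained in L. The action
   'Q %% C is defined on the larger groups 'N(K) / C and 'C_(|'Q)(C), hence the
   restriction to the subgroup generated by the copies of L / K and G / C. *)
Definition chief_sdprod (gT : finGroupType) (G L K : {group gT}) :=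
  let C := 'C_G(L / K | 'Q)%G in
  let to := ('Q %% C)%gact in
  (sdpair1 to @* (L / K) <*> sdpair2 to @* (G / C))%G.

Definition U_central (gT : finGroupType) (G L K : {group gT}) : bool :=
  supersolvable (chief_sdprod G L K).

(* On {group gT}, \prod is the join, which is the setwise product for normal
   subgroups. *)
Definition U_hypercentre (gT : finGroupType) (G : {group gT}) : {group gT} :=
  (\prod_(N : {group gT} | (N <| G) &&
     [forall K : {group gT}, forall L : {group gT},
        chief_factor G K L && (L \subset N) ==> U_central G L K]) N)%G.

(* The sequence s lists G_1, ..., G_n, so that the pairs (G_(i-1), G_i) are
   the pairs of consecutive terms of 1 :: s. *)
Definition partial_Pi_property (gT : finGroupType) (H G : {group gT}) : Prop :=
  exists s : seq {group gT},
    [/\ (G.-chief).-series 1%G s, last 1%G s = G &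
        forall i, i < size s ->
          let K := nth 1%G (1%G :: s) i in
          let L := nth 1%G s i in
          let A := (H * K) / K :&: L / K in
          \pi(A).-nat #|G / K : 'N_(G / K)(A)| ].

(* Main.v *)
(** Since Phi(P) lies in every maximal subgroup, maximal subgroups see only the
    chief factors of G between Phi(P) and P. Such a factor L/N has order p, by
    induction on |P : N|. If G has another minimal normal subgroup L2/N inside
    P/N, then L/N is isomorphic to the chief factor L L2/L2. Otherwise choose
    L1/N of index p in L/N and normalised by a Sylow p-subgroup S of G, and a
    maximal subgroup H of P with H :&: L = L1. By uniqueness of L, the partial
    Pi-property of H shows that |G : N_G(L1)| is a power of p. As S normalises
    L1, so does G, whence L1 = N.

    For the factors below Phi(P), let D be generated by G' and the (p-1)-th
    powers in G. It centralises all chief factors of order p, so its p'-elements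
    centralise P/Phi(P), hence P (Burnside). For any chief factor L/K below P, D
    then acts on L/K as a p-group, hence trivially. So G acts irreducibly on L/K
    through an abelian group of exponent dividing p - 1, and F_p is a splitting
    field for this group, which forces |L/K| = p. *)
Require Import Defs.
From mathcomp Require Import all_boot all_fingroup all_algebra all_solvable.
From mathcomp Require Import all_field all_character.

Import GroupScope.

(** * Chief factors detected by a maximal subgroup *)

Lemma chief_factorP (gT : finGroupType) (G K L : {group gT}) :
  reflect [/\ K <| G, L <| G, K \proper L &
             forall X : {group gT}, X <| G -> K \subset X -> X \subset L ->
               X :=: K \/ X :=: L]
          (chief_factor G K L).
Proof.
apply: (iffP andP) => [[/maxgroupP[/andP[pKL nKG] maxK] nLG]|[nK nL pKL mK]].
  split=> // [|X nX sKX sXL].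
    rewrite /normal nKG andbT.
    exact: subset_trans (proper_sub pKL) (normal_sub nLG).
  have [eXL|neXL] := eqVneq (X : {set gT}) L; first by right.
  by left; apply: maxK => //; rewrite properEneq neXL sXL normal_norm.
split=> //; apply/maxgroupP; split=> [|X /andP[pXL nXG] sKX].
  by rewrite pKL normal_norm.
have sXL := proper_sub pXL.
have nX : X <| G.
  by rewrite /normal nXG andbT; apply: subset_trans sXL (normal_sub nL).
by case: (mK X) => // eXL; rewrite eXL properxx in pXL.
Qed.

(* The chief factor is the pair of [G_(i-1) :&: P] and [G_i :&: P] for the
   first i such that [G_i :&: P] is not contained in H. *)
Lemma partial_Pi_chief_factor (gT : finGroupType) (p : nat)
    (G P H : {group gT}) :
  P <| G -> p.-group P -> H \proper P -> partial_Pi_property H G ->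
  exists K L : {group gT},
    [/\ chief_factor G K L /\ L \subset P, K \subset H, ~~ (L \subset H) &
        p.-nat #|G : 'N_G(H :&: L)|].
Proof.
move=> nPG pP /andP[sHP nsPH] [s [chs lasts idx]].
(* With the trivial group in front, [g i] is G_i, and the index condition at [j] concerns the pair
   [g j], [g j.+1]. *)
pose g i : {group gT} := nth 1%G (1%G :: s) i.
have g0 : g 0 = 1%G by [].
have gn : g (size s) = G.
  by rewrite -lasts (last_nth 1%G).
have exi : exists i, ~~ (g i :&: P \subset H).
  by exists (size s); rewrite gn (setIidPr (normal_sub nPG)).
case: (ex_minnP exi) => [[|j]] nsj minj.
  by rewrite g0 /= (setIidPl (sub1G _)) sub1G in nsj.
have ltj : j < size s.
  rewrite ltnNge; apply/negP => les; have := minj (size s).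
  rewrite gn (setIidPr (normal_sub nPG)) => /(_ nsPH).
  by rewrite ltnNge les.
have sKH : g j :&: P \subset H.
  by apply: contraT => /minj; rewrite ltnn.
have chj : chief_factor G (g j) (g j.+1).
  by have /(pathP 1%G)/(_ _ ltj) := chs.
have /chief_factorP[nK nL /proper_sub sKL mK] := chj.
have := idx _ ltj; rewrite /= -/(g j) -[nth _ s j]/(g j.+1).
set K := g j in sKH chj nK sKL mK *; set L := g j.+1 in nsj chj nL sKL mK *.
have nHK : H \subset 'N(K).
  exact: subset_trans (subset_trans sHP (normal_sub nPG)) (normal_norm nK).
rewrite quotientMidr -quotientIG // => idxj.
exists (K :&: P)%G, (L :&: P)%G; split=> //.
  split; last exact: subsetIr.
  apply/chief_factorP; split; rewrite ?normalI //.
    rewrite properEneq setSI // andbT; apply: contraNneq nsj => <-.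
    exact: sKH.
  move=> X nX sKX; rewrite subsetI => /andP[sXL sXP].
  have nXK : X \subset 'N(K).
    exact: subset_trans (normal_sub nX) (normal_norm nK).
  (* [X K] is [K] or [L]. In the second case Dedekind's law gives [L :&: P = X (K :&: P) = X]. *)
  have := mK (X <*> K)%G.
  rewrite /= (normalY nX nK) joing_subr join_subG sXL sKL.
  case=> // [defK|defL]; [left | right].
    apply/eqP; rewrite eqEsubset sKX subsetI sXP !andbT -defK.
    exact: joing_subl.
  rewrite -defL /= (norm_joinEl nXK) -group_modl //.
  by rewrite mulGSid.
(* [B] is the preimage in G of the intersection tested by the partial Pi-property. As [B / K] is a
   p-group, the index of its normaliser is a power of p. That normaliser also fixes
   [B :&: P = H :&: (L :&: P)]. *)
pose B := ((H :&: L) <*> K)%G.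
have nKB : H :&: L \subset 'N(K) by apply: subset_trans nHK; apply: subsetIl.
have defB : (H :&: L) / K = B / K by rewrite quotientYidr.
have pB : p.-group (B / K).
  by rewrite -defB quotient_pgroup //; apply: pgroupS pP; rewrite subIset ?sHP.
have nKBn : K <| B by rewrite /normal joing_subr join_subG nKB normG.
have idxB : p.-nat #|G : 'N_G(B)|.
  have sKN : K \subset 'N_G(B).
    rewrite subsetI normal_sub //.
    exact: subset_trans (normal_sub nKBn) (normG B).
  rewrite -(@index_quotient_eq _ G K 'N_G(B)) ?subsetIl ?normal_norm //;
    last by rewrite subIset // sKN orbT.
  rewrite quotientGI ?normal_sub //= quotient_normG //.
  rewrite defB in idxj; apply: sub_in_pnat idxj => q _.
  by move=> piq; apply: (pnatPpi pB).
apply: pnat_dvd idxB; apply: indexgS; rewrite subsetI subsetIl.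
have -> : H :&: (L :&: P) = B :&: P.
  rewrite /= norm_joinEl // -group_modl ?subIset ?sHP // mulGSid; last first.
    by rewrite subsetI sKH subIset // sKL.
  by rewrite setIA (setIidPl _) // subIset ?sHP.
apply: normsI; first exact: subsetIr.
exact: subset_trans (subsetIl _ _) (normal_norm nPG).
Qed.

(** * Chief factors between Phi(P) and P *)

Lemma chief_factor_exists (gT : finGroupType) (G N X : {group gT}) :
  N <| G -> X <| G -> N \proper X ->
  exists2 M : {group gT}, chief_factor G N M & M \subset X.
Proof.
move=> nN nX pNX; pose gP (M : {group gT}) := (M <| G) && (N \proper M).
have [|M /mingroupP[/andP[nM pNM] minM] sMX] := @mingroup_exists _ gP X.
  by rewrite /gP nX.
exists M => //; apply/chief_factorP; split=> // Y nY sNY sYM.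
have [eYN|neYN] := eqVneq (Y : {set gT}) N; [by left | right].
by apply: minM; rewrite // /gP nY properEneq eq_sym neYN.
Qed.

(** This is the second isomorphism theorem, compatible with the action of G: by Dedekind's law, each
    [X] between [M] and [L M] is [(X :&: L) M]. *)
Lemma chief_factorY (gT : finGroupType) (G N L M : {group gT}) :
    chief_factor G N L -> M <| G -> L :&: M = N ->
  chief_factor G M (L <*> M) /\ #|L <*> M : M| = #|L : N|.
Proof.
case/chief_factorP=> nN nL pNL mN nM defN.
have nML : L \subset 'N(M).
  exact: subset_trans (normal_sub nL) (normal_norm nM).
have eqi : #|L <*> M : M| = #|L : N|.
  by rewrite joingC norm_joinEr // indexMg -indexgI defN.
split=> //; apply/chief_factorP; split=> [|||X nX sMX sXLM] //.
- exact: normalY.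
- rewrite properEneq joing_subr andbT; apply/eqP=> eM.
  move: eqi; rewrite /= -eM indexgg => /esym/eqP; rewrite indexg_eq1 => sLN.
  by rewrite properE sLN andbF in pNL.
have defX : X :=: (X :&: L) * M.
  by rewrite group_modr // -(norm_joinEl nML) (setIidPl _).
case: (mN (X :&: L)%G) => [|||eX|eX]; first exact: normalI.
- by rewrite subsetI (proper_sub pNL) (subset_trans _ sMX) // -defN subsetIr.
- exact: subsetIr.
- by left; rewrite defX eX mulSGid // -defN subsetIr.
by right; rewrite defX eX /= norm_joinEl.
Qed.

Lemma chief_factor_above_Phi (gT : finGroupType) (p : nat)
    (G P N L : {group gT}) :
    prime p -> P <| G -> p.-group P ->
    (forall H : {group gT}, maximal H P -> partial_Pi_property H G) ->
  'Phi(P) \subset N -> L \subset P -> chief_factor G N L -> #|L : N| = p.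
Proof.
move=> pr_p nPG pP piP; have [m] := ubnP #|P : N|.
elim: m N L => // m IHm N L ltm sPhiN sLP chL.
have /chief_factorP[nN nL pNL mN] := chL.
have sNL := proper_sub pNL; have sNP := subset_trans sNL sLP.
have [/existsP[M /and3P[chM sMP neML]]|uniqL] :=
      boolP [exists M : {group gT},
              [&& chief_factor G N M, M \subset P & M != L]].
  have /chief_factorP[_ nM pNM mM] := chM.
  have defN : L :&: M = N.
    have sNLM : N \subset L :&: M by rewrite subsetI sNL proper_sub.
    have nLM : L :&: M <| G by apply: normalI.
    case: (mN (L :&: M)%G) => //= [|/setIidPl sLM]; first exact: subsetIl.
    case: (mM L) => // [eLN|eLM]; first by rewrite eLN properxx in pNL.
    by case/eqP: neML; apply: val_inj.
  have [chLM <-] := chief_factorY _ _ _ _ _ chL nM defN.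
  apply: IHm chLM.
  - rewrite -ltnS; apply: leq_trans ltm; rewrite ltnS.
    rewrite -(Lagrange_index sMP (proper_sub pNM)) ltn_Pmulr //.
    by rewrite indexg_gt1 proper_subn.
  - exact: subset_trans (proper_sub pNM).
  - by rewrite /= join_subG sLP.
(* [N X / N] is nontrivial, so it contains a minimal normal subgroup of [G / N], which can only be
   [L / N]. *)
have {uniqL}sLX (X : {group gT}) :
    X <| G -> X \subset P -> ~~ (X \subset N) -> L \subset N <*> X.
  move=> nX sXP nsXN; have nNX : N <*> X <| G by apply: normalY.
  have pNNX : N \proper N <*> X by rewrite /proper joing_subl join_subG subxx.
  have [M chM sMX] := chief_factor_exists _ _ _ (N <*> X)%G nN nNX pNNX.
  move: uniqL; rewrite negb_exists => /forallP/(_ M).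
  rewrite chM (subset_trans sMX) ?join_subG ?sNP //= negbK => /eqP <-.
  exact: sMX.
have [S sylS] := Sylow_exists p G.
have [sSG pS _] := and3P sylS.
have sPS : P \subset S by apply: normal_sub_max_pgroup (Hall_max sylS) pP nPG.
have [L1 [nL1 sNL1 sL1L iL1]] : exists L1 : {group gT},
    [/\ L1 <| S, N \subset L1, L1 \subset L & #|L : L1| = p].
  have nNS : N <| S by apply: normalS nN => //; apply: subset_trans sPS.
  have nLS : L <| S by apply: normalS nL => //; apply: subset_trans sPS.
  have pLN : p.-group (L / N) by apply/quotient_pgroup/(pgroupS sLP).
  have nNL : L \subset 'N(N) := subset_trans (normal_sub nL) (normal_norm nN).
  have ntLN : L / N != 1 by rewrite -subG1 quotient_sub1 ?proper_subn.
  (* A normal subgroup of a p-group contains normal subgroups of the whole group of every possible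
     order. The predecessor of the logarithm selects index p. *)
  have [Q [sQL nQS oQ]] := normal_pgroup (quotient_pgroup N pS)
    (quotient_normal N nLS) (leq_pred (logn p #|L / N|)).
  have [L1 defQ sNL1 nL1] := inv_quotientN nNS nQS.
  have nNL1 : L1 \subset 'N(N).
    exact: subset_trans (normal_sub nL1) (normal_norm nNS).
  have sL1L : L1 \subset L by rewrite -(quotientSGK nNL1 sNL) -defQ.
  exists L1; split=> //.
  rewrite -(@index_quotient_eq _ L N L1) //;
    last by rewrite subIset // sNL1 orbT.
  rewrite -divgS ?quotientS //= -defQ oQ (card_pgroup pLN).
  have := pgroup_pdiv pLN ntLN; case=> _ _ [k ok].
  rewrite ok !pfactorK //= expnS mulnK // expn_gt0 prime_gt0 //.
(* As Phi(P) lies in [L1], the maximal subgroups of [P / L1] intersect trivially, so one of them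
   misses [L / L1], which is nontrivial. *)
have [H [maxH sL1H nsLH]] : exists H : {group gT},
    [/\ maximal H P, L1 \subset H & ~~ (L \subset H)].
  have nL1P : L1 <| P by apply: normalS nL1 => //; apply: subset_trans sLP.
  have nL1L : L1 <| L by apply: normalS nL1P.
  have Phi1 : 'Phi(P / L1) = 1.
    rewrite -(quotient_Phi pP) ?normal_norm //; apply: quotientS1.
    exact: subset_trans sNL1.
  have : ~~ (L / L1 \subset 'Phi(P / L1)).
    rewrite Phi1 quotient_sub1 ?normal_norm //.
    apply/negP=> sLL1; move: (prime_gt1 pr_p).
    by rewrite -iL1 indexg_gt1 sLL1.
  have [/existsP[M /andP[maxM nsLM]]|noM] := boolP
      [exists M : {group coset_of L1},
         maximal_eq M (P / L1) && ~~ (L / L1 \subset M)].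
    move=> _; exists (coset L1 @*^-1 M)%G; rewrite sub_cosetpre.
    have nL1L' : L \subset 'N(L1) by apply: normal_norm.
    have maxM' : maximal M (P / L1).
      (* [maximal_eq] also admits the whole group [P / L1], but that contains [L / L1]. *)
      case/predU1P: maxM => // defM; case/negP: nsLM.
      by rewrite defM quotientS.
    split=> //; last by rewrite -sub_quotient_pre.
    by rewrite -(quotientGK nL1P) cosetpre_maximal.
  case/negP; apply/bigcapsP => M maxM; move: noM.
  by rewrite negb_exists => /forallP/(_ M); rewrite maxM negbK.
have pHP : H \proper P by apply: maxgroupp maxH.
have sHP := proper_sub pHP.
have sNH := subset_trans sNL1 sL1H.
have sLH_L1 : H :&: L = L1.
  apply/eqP; rewrite eq_sym eqEcard subsetI sL1H sL1L /=.
  have sHLL : H :&: L \subset L := subsetIr H L.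
  have sL1HL : L1 \subset H :&: L by rewrite subsetI sL1H.
  have iHL : #|L : H :&: L| = p.
    have : #|L : H :&: L| %| p by rewrite -iL1; apply: indexgS.
    case/primeP: pr_p => _ pr_p' /pr_p' /pred2P[] //.
    move/eqP; rewrite indexg_eq1 subsetI => /andP[sLH _].
    by rewrite sLH in nsLH.
  rewrite -(leq_pmul2r (prime_gt0 pr_p)) -{1}iHL -iL1.
  by rewrite !Lagrange.
have [K' [L' [[chL' sL'P] sK'H nsL'H iHL']]] :=
  partial_Pi_chief_factor _ _ _ _ _ nPG pP pHP (piP H maxH).
have /chief_factorP[nK' nL' pKL' mK'] := chL'.
(* Otherwise [L] would lie in [N K'], hence in [H]. The chief factor [L' / K'] turns out to cover
   [L / N]: [L = N L'] and [L1 = N (H :&: L')], so whatever normalises [H :&: L'] normalises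
   [L1]. *)
have sK'N : K' \subset N.
  apply: contraR nsLH => nsK'N; apply: subset_trans (sLX K' _ _ _) _ => //.
    exact: subset_trans (proper_sub pKL') sL'P.
  by rewrite join_subG sNH.
have nsL'N : ~~ (L' \subset N).
  by apply: contra nsL'H => sL'N; apply: subset_trans sNH.
have sLNL' := sLX L' nL' sL'P nsL'N.
have nNL' : L' \subset 'N(N).
  exact: subset_trans (normal_sub nL') (normal_norm nN).
have sL'L : L' \subset L.
  have [||eK'|eL'] := mK' (L :&: L')%G (normalI nL nL').
  - by rewrite subsetI (subset_trans sK'N) ?proper_sub.
  - exact: subsetIr.
  - have defL : L :=: N * (L :&: L').
      by rewrite setIC group_modl // -(norm_joinEr nNL') (setIidPr _).
    by case/negP: (proper_subn pNL); rewrite defL [L :&: L']eK' mul_subG.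
  by rewrite -eL' subsetIl.
have defL : L :=: N * L'.
  by apply/eqP; rewrite eqEsubset -{1}(norm_joinEr nNL') sLNL' mul_subG.
have defL1 : L1 :=: N * (H :&: L').
  by rewrite setIC group_modl // -defL -sLH_L1 setIC.
have nL1G : L1 <| G.
  rewrite /normal (subset_trans sL1L (normal_sub nL)) /=.
  have nNL1 : 'N_G(H :&: L') \subset 'N_G(L1).
    rewrite subsetI subsetIl defL1 normsM ?subsetIr //.
    exact: subset_trans (subsetIl _ _) (normal_norm nN).
  (* The index is a power of p by the partial Pi-property, and prime to p because it divides
     [#|G : S|]. *)
  suff : #|G : 'N_G(L1)| == 1%N.
    by rewrite indexg_eq1 subsetI => /andP[_].
  rewrite -(@pnat_1 p #|G : 'N_G(L1)|) //.
    by apply: pnat_dvd iHL'; apply: indexgS.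
  apply: (@pnat_dvd _ #|G : S|); last by case/and3P: sylS.
  by apply: indexgS; rewrite subsetI sSG normal_norm.
have [eL1|eL1] := mN L1 nL1G sNL1 sL1L.
  by rewrite -eL1.
by move: sL1H; rewrite eL1 (negPf nsLH).
Qed.

(** * Irreducible actions in characteristic p *)

Lemma finField_prim_root (F : finFieldType) :
  exists z : F, (#|F|.-1).-primitive_root%R z.
Proof.
have F_gt0 : 0 < #|F|.-1 by rewrite -subn1 subn_gt0 finNzRing_gt1.
have /hasP[z _ prz] : has (#|F|.-1).-primitive_root%R (enum (predC1 (0%R : F))).
  apply: has_prim_root; rewrite ?enum_uniq -?cardE ?cardC1 //.
  apply/allP=> x; rewrite mem_enum unity_rootE => nzx.
  apply/eqP/(GRing.mulfI nzx).
  rewrite -GRing.exprS prednK ?expf_card ?GRing.mulr1 //.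
  exact: ltnW (finNzRing_gt1 F).
by exists z.
Qed.

(** Conjugation embeds the quotient in Aut(E), which is cyclic of order [#|E|.-1]. *)
Lemma quotient_cent_prime (gT : finGroupType) (E : {group gT}) :
  prime #|E| -> cyclic ('N(E) / 'C(E)) /\ #|'N(E) / 'C(E)| %| #|E|.-1.
Proof.
move=> prE; have isoA := first_isog (conj_aut E).
rewrite ker_conj_aut in isoA; split.
  rewrite (isog_cyclic isoA); apply: cyclicS (Aut_conj_aut _ _) _.
  exact: Aut_prime_cyclic.
rewrite (card_isog isoA) -(totient_prime prE) -card_Aut_cyclic ?prime_cyclic //.
exact: cardSg (Aut_conj_aut _ _).
Qed.

(** An abelian group with a faithful irreducible representation is cyclic, so its order equals its
    exponent and divides p - 1. Then F_p contains a primitive root of unity of that order, and the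
    irreducible module [E] has dimension 1. *)
Lemma minnormal_abelian_exponent_card (gT : finGroupType) (p : nat)
    (G E : {group gT}) :
    prime p -> p.-group E -> minnormal E G ->
    abelian (G / 'C_G(E)) -> exponent (G / 'C_G(E)) %| p.-1 ->
  #|E| = p.
Proof.
move=> pr_p pE minE.
have [/andP[ntE nEG] _] := mingroupP minE.
have [_ _] := minnormal_solvable minE (subxx E) (pgroup_sol pE).
rewrite (is_abelem_pgroup pE) => abelE.
have irrG := elimT (abelem_mx_irrP abelE ntE nEG) minE.
rewrite -(rker_abelem abelE ntE nEG).
set rG := abelem_repr _ _ _ in irrG *; move=> abG.
have irrQ : mx_irreducible (kquo_repr rG) by apply/quo_mx_irr.
have cycG := mx_faithful_irr_abelian_cyclic (kquo_mx_faithful rG) irrQ abG.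
rewrite exponent_cyclic // => dvdG.
have [z] := finField_prim_root 'F_p; rewrite card_Fp // => prz.
have splitG := primitive_root_splitting_abelian (dvdn_prim_root prz dvdG) abG.
have := splitG _ _ irrQ.
rewrite abelian_abs_irr // (dim_abelemE abelE ntE) => /eqP dimE.
by rewrite (card_pgroup pE) dimE.
Qed.

(** A group with a faithful irreducible representation in characteristic p has trivial p-core, while
    the image of [D] modulo the kernel of the action on [E] is a normal p-subgroup. *)
Lemma minnormal_pgroup_cent (gT : finGroupType) (p : nat)
    (G E D : {group gT}) :
    prime p -> p.-group E -> minnormal E G ->
    D <| G -> {in D, forall x, p^'.-elt x -> x \in 'C(E)} ->
  D \subset 'C(E).
Proof.
move=> pr_p pE minE nDG cD.
have [/andP[ntE nEG] _] := mingroupP minE.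
have [_ _] := minnormal_solvable minE (subxx E) (pgroup_sol pE).
rewrite (is_abelem_pgroup pE) => abelE.
have irrG := elimT (abelem_mx_irrP abelE ntE nEG) minE.
have := rker_abelem abelE ntE nEG.
set rG := abelem_repr _ _ _ in irrG * => kerG.
have irrQ : mx_irreducible (kquo_repr rG) by apply/quo_mx_irr.
have := pcore_faithful_mx_irr_pchar (pchar_Fp pr_p) irrQ (kquo_mx_faithful rG).
have nkD : D \subset 'N(rker rG).
  by rewrite (subset_trans (normal_sub nDG)) ?rker_norm.
move=> Op1; apply: (@subset_trans _ _ (rker rG)); last by rewrite kerG subsetIr.
rewrite -quotient_sub1 // -Op1; apply: pcore_max; last exact: quotient_normal.
(* An element of prime order q other than p in the image of [D] is the image of the p'-part of a
   preimage, which acts trivially. *)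
apply/pgroupP=> q pr_q /Cauchy[] // _ /morphimP[x nx Dx ->] oq.
apply: contraT => neqp.
have p'q : p^'.-elt (coset (rker rG) x).
  by rewrite /p_elt oq pnatE // inE.
have Dxp : x.`_p^' \in D by rewrite groupX.
have kxp : x.`_p^' \in rker rG.
  by rewrite kerG inE (subsetP (normal_sub nDG)) // cD ?p_elt_constt.
have := constt_p_elt p'q; rewrite -morph_constt //= (coset_id kxp) => x1.
by move: oq pr_q; rewrite /= -x1 order1 => <-.
Qed.

(** * From P/Phi(P) down to all chief factors below P *)

Lemma p'group_chief_cent (gT : finGroupType) (p : nat) (G P A : {group gT}) :
    P <| G -> p.-group P -> p^'.-group A -> A \subset G ->
    (forall K L : {group gT}, 'Phi(P) \subset K -> L \subset P ->
       chief_factor G K L -> A / K \subset 'C(L / K)) ->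
  A \subset 'C(P).
Proof.
move=> nPG pP p'A sAG cA.
have nPhiG : 'Phi(P) <| G by apply: gFnormal_trans.
have nAP : A \subset 'N(P) by apply: subset_trans (normal_norm nPG).
have coPA : coprime #|P| #|A| by apply: pnat_coprime pP p'A.
have solP := pgroup_sol pP.
(* In a coprime action, fixed points of [X / Y] lift to fixed points of [X]. *)
have cent_id (X Y : {group gT}) : X <| G -> Y <| G -> Y \subset X ->
    X \subset P -> A / Y \subset 'C(X / Y) -> X \subset Y * 'C_X(A).
  move=> nX nY sYX sXP cAX.
  have sYP := subset_trans sYX sXP.
  have nYA : A \subset 'N(Y) := subset_trans sAG (normal_norm nY).
  have nXA : A \subset 'N(X) := subset_trans sAG (normal_norm nX).
  have nYX : X \subset 'N(Y) := subset_trans (normal_sub nX) (normal_norm nY).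
  rewrite -quotientSK //.
  rewrite coprime_norm_quotient_cent ?(coprimeSg sYP) ?(solvableS sYP) //.
  by rewrite subsetI subxx centsC.
(* Once [A] centralises P/Phi(P), [P] is generated by Phi(P) and ['C_P(A)], and the elements of
   Phi(P) are nongenerators. The induction climbs a chief series of G from Phi(P) to P. *)
suffices cX n (X : {group gT}) : #|X| < n -> X <| G -> 'Phi(P) \subset X ->
    X \subset P -> A / 'Phi(P) \subset 'C(X / 'Phi(P)).
  have cAP := cX _ P (ltnSn _) nPG (Phi_sub P) (subxx P).
  have sPC := cent_id P 'Phi(P)%G nPG nPhiG (Phi_sub P) (subxx P) cAP.
  have genP : 'Phi(P) <*> 'C_P(A) = P.
    apply/eqP; rewrite eqEsubset join_subG Phi_sub subsetIl.
    by rewrite (subset_trans sPC) ?mulG_subG ?mul_subG ?joing_subl ?joing_subr.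
  by rewrite centsC; apply/setIidPl; rewrite -[RHS](Phi_nongen genP) genGid.
elim: n X => // n IHn X ltX nX sPhiX sXP.
have [eX|neX] := eqVneq ('Phi(P) : {set gT}) X.
  by rewrite -eX trivg_quotient cents1.
have [K maxK] : {K : {group gT} |
    [max K | (K <| G) && ('Phi(P) \subset K) && (K \proper X)]}.
  by apply: ex_maxgroup; exists 'Phi(P)%G; rewrite nPhiG subxx properEneq neX.
have /maxgroupP[/andP[/andP[nK sPhiK] pKX] mK] := maxK.
have chK : chief_factor G K X.
  apply/chief_factorP; split=> // Y nY sKY sYX.
  have [eYX|neYX] := eqVneq (Y : {set gT}) X; [by right | left].
  by apply: mK; rewrite // nY (subset_trans sPhiK) // properEneq neYX.
have cXK := cA K X sPhiK sXP chK.
have sKX := proper_sub pKX; have sKP := subset_trans sKX sXP.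
have sXKC := cent_id X K nX nK sKX sXP cXK.
have cK : A / 'Phi(P) \subset 'C(K / 'Phi(P)).
  by apply: IHn => //; apply: leq_trans (proper_card pKX) _.
rewrite (subset_trans _ (centS (quotientS _ sXKC))) // quotientMl; last first.
  exact: subset_trans (normal_sub nK) (normal_norm nPhiG).
by rewrite centM subsetI cK quotient_cents // centsC subsetIr.
Qed.

Lemma chief_factor_below_Phi (gT : finGroupType) (p : nat) (G P : {group gT}) :
    prime p -> P <| G -> p.-group P ->
    (forall K L : {group gT}, 'Phi(P) \subset K -> L \subset P ->
       chief_factor G K L -> #|L : K| = p) ->
  forall K L : {group gT}, L \subset P -> chief_factor G K L -> #|L : K| = p.
Proof.
move=> pr_p nPG pP primePhi K L sLP chKL.
pose D := <<G^`(1) :|: [set x ^+ p.-1 | x in G]>>%G.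
have sDG : D \subset G.
  rewrite gen_subG subUset der_sub /=.
  by apply/subsetP=> _ /imsetP[x Gx ->]; apply: groupX.
have sG'D : G^`(1) \subset D by rewrite sub_gen // subsetUl.
have nDG : D <| G by apply: sub_der1_normal.
have XD x : x \in G -> x ^+ p.-1 \in D.
  by move=> Gx; apply/mem_gen/setUP; right; apply: imset_f.
(* G acts on a factor of order p through a cyclic group of order dividing p - 1, in which
   commutators and (p-1)-th powers vanish. *)
have cD (M N : {group gT}) : 'Phi(P) \subset M -> N \subset P ->
    chief_factor G M N -> D / M \subset 'C(N / M).
  move=> sPhiM sNP chMN; have oNM := primePhi M N sPhiM sNP chMN.
  have /chief_factorP[nM nN /proper_sub sMN _] := chMN.
  have nMG := normal_norm nM.
  have nMN : M <| N by apply: normalS nM => //; apply: normal_sub.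
  have oE : #|N / M| = p by rewrite card_quotient ?normal_norm.
  have prE : prime #|N / M| by rewrite oE.
  have [cycQ] := quotient_cent_prime _ (N / M)%G prE; rewrite /= oE => dvdQ.
  have nE : G / M \subset 'N(N / M) by rewrite quotient_norms ?normal_norm.
  have nMD : D \subset 'N(M) := subset_trans sDG nMG.
  have nMG' : G^`(1) \subset 'N(M) := subset_trans (der_sub 1 G) nMG.
  rewrite sub_quotient_pre // gen_subG subUset.
  rewrite -sub_quotient_pre // quotient_der //.
  have sE'C : 'N(N / M)^`(1) \subset 'C(N / M).
    by rewrite der1_min ?cyclic_abelian // normal_norm ?(cent_normal (N / M)%G).
  rewrite (subset_trans (dergS 1 nE) sE'C) /=.
  apply/subsetP=> _ /imsetP[x Gx ->].
  have nMx := subsetP nMG x Gx.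
  rewrite mem_morphpre ?groupX // morphX //=.
  have nEx : coset M x \in 'N(N / M) by rewrite (subsetP nE) ?mem_quotient.
  have nCx := subsetP (normal_norm (cent_normal (N / M)%G)) _ nEx.
  apply: coset_idr; first by rewrite groupX.
  rewrite morphX //; apply/eqP; rewrite -order_dvdn.
  by apply: dvdn_trans dvdQ; apply: order_dvdG; apply: mem_quotient.
have p'cP x : x \in D -> p^'.-elt x -> x \in 'C(P).
  move=> Dx p'x; rewrite -cycle_subG.
  apply: (p'group_chief_cent _ _ _ _ _ nPG pP p'x).
    by rewrite cycle_subG (subsetP sDG).
  move=> M N sPhiM sNP chMN; apply: subset_trans (cD M N sPhiM sNP chMN).
  by rewrite quotientS ?cycle_subG.
have /chief_factorP[nK nL /proper_sub sKL _] := chKL.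
have nKG := normal_norm nK.
have minE := chief_factor_minnormal chKL.
have pE : p.-group (L / K) by apply/quotient_pgroup/(pgroupS sLP).
have cDE : D / K \subset 'C(L / K).
  apply: (minnormal_pgroup_cent _ _ (G / K)%G (L / K)%G _ pr_p pE minE).
    exact: quotient_normal.
  (* A p'-element of [D / K] is also the image of the p'-part of [x], which centralises [P] and so
     [L]. *)
  move=> _ /morphimP[x nKx Dx ->] p'x.
  have := constt_p_elt p'x; rewrite -morph_constt //= => <-.
  have cx : x.`_p^' \in 'C(L).
    by rewrite (subsetP (centS sLP)) // p'cP ?groupX ?p_elt_constt.
  by rewrite (subsetP (quotient_cent _ _)) // mem_quotient.
have nKL : L \subset 'N(K) := subset_trans (normal_sub nL) nKG.
rewrite -card_quotient //.
apply: (minnormal_abelian_exponent_card _ _ _ _ pr_p pE minE).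
  rewrite sub_der1_abelian // subsetI der_sub -quotient_der //.
  exact: subset_trans (quotientS _ sG'D) cDE.
apply/exponentP=> _ /morphimP[z nCz /morphimP[x nKx Gx defz] ->].
rewrite {z}defz in nCz *.
rewrite -morphX //= coset_id // inE groupX ?mem_quotient //= -morphX //.
by rewrite (subsetP cDE) // mem_quotient ?XD.
Qed.

(** * Chief factors of prime order are U-central *)

Lemma prime_chief_factor_U_central (gT : finGroupType) (G K L : {group gT}) :
  chief_factor G K L -> prime #|L : K| -> U_central G L K.
Proof.
move=> /chief_factorP[nK nL /proper_sub sKL _] prLK.
have nKG := normal_norm nK.
have nKL : K <| L by apply: normalS nK => //; apply: normal_sub.
have prE : prime #|L / K| by rewrite card_quotient ?normal_norm.
have cycE := prime_cyclic prE.
rewrite /U_central /supersolvable /chief_sdprod.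
set C := 'C_G(L / K | 'Q)%G; set to := ('Q %% C)%gact.
have sCG : C \subset G by apply: subsetIl.
have actG : [acts G, on L / K | 'Q] by rewrite actsQ ?normal_norm.
have sCQ : C \subset 'C(L / K | 'Q) by apply: subsetIr.
have nCG : G \subset 'N(C).
  by rewrite normsI ?normG // (subset_trans actG) ?astab_norm.
have nCG' : C <| G by rewrite /normal sCG.
have sKC : K \subset C.
  rewrite subsetI normal_sub // sub_astabQ normG trivg_quotient sub1G //.
(* Hence the isomorphism theorems embed [G / C] in ['N(L / K) / 'C(L / K)], which is cyclic. *)
have defCK : C / K = 'C(L / K) :&: (G / K).
  by rewrite /= quotientGI ?normal_sub // quotient_astabQ setIC.
have cycQ : cyclic (G / C).
  rewrite -(isog_cyclic (third_isog sKC nK nCG')) defCK.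
  have nCE : G / K \subset 'N('C(L / K)).
    apply: subset_trans (normal_norm (cent_normal (L / K)%G)).
    by rewrite quotient_norms ?normal_norm.
  rewrite (isog_cyclic (second_isog nCE)).
  have [cycNC _] := quotient_cent_prime _ (L / K)%G prE.
  apply: cyclicS cycNC; apply: quotientS.
  by rewrite quotient_norms ?normal_norm.
set X1 := sdpair1 to @* (L / K); set X2 := sdpair2 to @* (G / C).
have cycX1 : cyclic X1 by apply: morphim_cyclic.
have cycX2 : cyclic X2 by apply: morphim_cyclic.
have nX12 : X2 \subset 'N(X1).
  rewrite -actsEsd.
  - by rewrite astabs_mod // quotientS.
  - by rewrite quotientS //= dom_qactJ.
  by rewrite /= gacentQ centsC defCK subsetIl.
(* The semidirect product is cyclic by cyclic, and [X1] is the only intermediate term needed in the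
   chain. *)
have X1X : X1 <| X1 <*> X2 by rewrite /normal joing_subl join_subG normG.
apply/connectP; exists [:: sdpair1 to @* (L / K); X1 <*> X2]%G => //=.
rewrite normal1 normal_refl sub1G X1X joing_subl quotientYidl //.
by rewrite -(isog_cyclic (quotient1_isog X1)) cycX1 quotient_cyclic.
Qed.

Theorem proposition1p3 (gT : finGroupType) (p : nat) (G P : {group gT}) :
  prime p -> P <| G -> p.-group P ->
  (forall M : {group gT}, maximal M P -> partial_Pi_property M G) ->
  P \subset U_hypercentre G.
Proof.
move=> pr_p nPG pP piP.
have prime_above K L := chief_factor_above_Phi _ _ _ _ K L pr_p nPG pP piP.
have prime_below := chief_factor_below_Phi _ _ _ _ pr_p nPG pP prime_above.
rewrite /U_hypercentre (bigD1 P) /= ?joing_subl //.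
rewrite nPG; apply/forallP=> K; apply/forallP=> L.
apply/implyP=> /andP[chKL sLP].
by apply: prime_chief_factor_U_central; rewrite // (prime_below K L).
Qed.
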